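(* Let $k$ be a field of characteristic $p>0$. For every tuple $R$ and every tuple $F$, the Hopf algebras $H_R$ and $H_F$ over $k$ are pointed. The Hopf algebra $H_R$ is of rank one if and only if $r=0$. The Hopf algebra $H_F$ is of rank one.
   Context: For a finite-dimensional Hopf algebra $H$ over $k$: $G(H)$ is the group of group-like elements; the coradical $H_0$ is the sum of the simple subcoalgebras; $H_1=\Delta^{-1}(H\otimes H_0+H_0\otimes H)$. $H$ is pointed if all simple subcoalgebras are one-dimensional, so that $H_0=kG(H)$. A pointed $H$ has rank $t$ if $\dim_k k\otimes_{H_0}H_1=t+1$ ($k$ trivial via the counit). First type $H_R$. Let $R=(G,\chi,a,\alpha)$ where $G$ is a finite group, $a\in Z(G)$, $\chi:G\to k^*$ a linear character with $\chi(a)\ne 1$, $\alpha=(\alpha_{-1},\alpha_0,\dots,\alpha_{r-1})\in k^{r+1}$, $r\ge 0$. Let $N$ be the order of $\chi(a)$ and $n=p^rN$. It is assumed that $\alpha_{-1}=0$ if $a^n=1$; that if $\alpha_i\ne0$ for some $i\ge0$ then $a^{N(p^r-p^i)}=1$ and $\chi(g)^{N(p^r-p^i)}=1$ for all $g\in G$; and that if $\alpha_{-1}\neq0$ then $\chi(g)^{Np^r}=1$ for all $g\in G$. $H_R$ is the algebra containing $kG$ and an element $x$, with basis $(gx^i)_{g\in G,\,0\le i\le n-1}$ and relations $gxg^{-1}=\chi(g)x$ ($g\in G$), $x^n=\alpha_{-1}(a^n-1)+\sum_{i=0}^{r-1}\alpha_ix^{p^iN}$; its Hopf structure is $\Delta(gx^i)=(g\otimes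 g)(x\otimes a+1\otimes x)^i$, $\epsilon(gx^i)=\delta_{i,0}$, $S(gx^i)=(-xa^{-1})^ig^{-1}$. Second type $H_F$. Let $F=(G,\chi,c,a,(\alpha_{-1},\alpha_0))$ where $G$ is a finite group, $a\in Z(G)$, $\chi:G\to k^*$ a linear character with $\chi(a)=1$, $c:G\to k$ a map with $c(hg)=\chi(g)c(h)+c(g)$ for all $g,h\in G$ and $c(a)=0$, and $\alpha_{-1},\alpha_0\in k$ with $\alpha_0\in\{0,1\}$ and $\alpha_{-1}=0$ if $\alpha_0=0$. It is assumed that if $\alpha_0=0$ then $c(g)(a^p-1)=0$ in $kG$ for all $g\in G$; and if $\alpha_0=1$ then $a^p=a$, and for all $g\in G$ one has $\chi(g)\in\mathbb{F}_p^*$ and $(\alpha_{-1}(\chi(g)-1)+c(g)^p-c(g))(a-1)=0$ in $kG$. $H_F$ is the algebra containing $kG$ and an element $x$, with basis $\{gx^i: g\in G,0\le i\le p-1\}$ and relations $x^p=\alpha_{-1}(a^p-1)+\alpha_0x$, $gxg^{-1}=\chi(g)x+c(g)(a-1)$ ($g\in G$); its Hopf structure is $\Delta(gx^i)=(g\otimes g)(x\otimes a+1\otimes x)^i$, $\epsilon(gx^i)=\delta_{i,0}$, $S(gx^i)=(-xa^{-1})^ig^{-1}$. *)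

(* Defs.v *)
From HB Require Import structures.
From mathcomp Require Import all_boot all_order all_algebra all_fingroup.
From mathcomp Require Import all_solvable all_field.
From mathcomp Require Import boolp classical_sets.
Set Implicit Arguments.
Unset Strict Implicit.
Unset Printing Implicit Defensive.
Import GRing.Theory VectorInternalTheory.
Local Open Scope ring_scope.

(* The entries of a matrix are the coordinates of a tensor on the tensors of  *)
(* the canonical basis vectors. [tlift] gives the universal property: see     *)
(* [tliftE] and [tensor_ext].                                                 *)
Definition tensor (k : fieldType) (V W : vectType k) : Type :=
  'M[k]_(dim V, dim W).

HB.instance Definition _ (k : fieldType) (V W : vectType k) :=
  Vector.on (tensor V W).

Definition tens (k : fieldType) (V W : vectType k) (v : V) (w : W)
  : tensor V W := (v2r v)^T *m v2r w.

Definition cbase (k : fieldType) (V : vectType k) (i : 'I_(dim V)) : V :=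
  r2v (delta_mx 0 i).

Definition tlift (k : fieldType) (V W U : vectType k) (f : V -> W -> U)
    (X : tensor V W) : U :=
  \sum_i \sum_j (X : 'M_(_, _)) i j *: f (cbase i) (cbase j).

Section TensorTheory.
Context (k : fieldType).
Implicit Types V W U : vectType k.

Lemma tens_linearl V W (w : W) : linear ((@tens k V W)^~ w).
Proof. by move=> c u v; rewrite /tens !linearP /= mulmxDl -scalemxAl. Qed.

Lemma tens_linearr V W (v : V) : linear (@tens k V W v).
Proof. by move=> c u w; rewrite /tens !linearP. Qed.

HB.instance Definition _ V W (v : V) :=
  GRing.isLinear.Build k W (tensor V W) _ (@tens k V W v) (tens_linearr v).

Lemma tensDl V W (u v : V) (w : W) : tens (u + v) w = tens u w + tens v w.
Proof. by have := tens_linearl w 1 u v; rewrite !scale1r. Qed.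

Lemma tensZl V W c (u : V) (w : W) : tens (c *: u) w = c *: tens u w.
Proof.
have t0 : tens 0 w = 0 :> tensor V W by rewrite /tens linear0 trmx0 mul0mx.
by have := tens_linearl w c u 0; rewrite addr0 t0 addr0.
Qed.

Lemma cbase_sum V (v : V) : v = \sum_i v2r v 0 i *: cbase i.
Proof.
rewrite -{1}[v]v2rK [v2r v in LHS]row_sum_delta linear_sum.
by apply: eq_bigr => i _; rewrite linearZ.
Qed.

Lemma tlift_linear V W U (f : V -> W -> U) : linear (tlift f).
Proof.
move=> c X Y; rewrite /tlift scaler_sumr -big_split; apply: eq_bigr => i _ /=.
rewrite scaler_sumr -big_split; apply: eq_bigr => j _ /=.
by rewrite !mxE scalerDl scalerA.
Qed.

HB.instance Definition _ V W U (f : V -> W -> U) :=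
  GRing.isLinear.Build k (tensor V W) U _ (tlift f) (tlift_linear f).

Lemma tliftE V W U (f : V -> W -> U) :
    (forall v, linear (f v)) -> (forall w, linear (f^~ w)) ->
  forall v w, tlift f (tens v w) = f v w.
Proof.
move=> fr fl v w.
pose fL w' : {linear V -> U} :=
  HB.pack (f^~ w') (GRing.isLinear.Build k V U _ (f^~ w') (fl w')).
pose fR v' : {linear W -> U} :=
  HB.pack (f v') (GRing.isLinear.Build k W U _ (f v') (fr v')).
have -> : f v w = \sum_i v2r v 0 i *: f (cbase i) w.
  rewrite [LHS](_ : _ = fL w (\sum_i v2r v 0 i *: cbase i)).
    by rewrite linear_sum; apply: eq_bigr => i _; rewrite linearZ.
  by rewrite -cbase_sum.
apply: eq_bigr => i _.
have -> : f (cbase i) w = \sum_j v2r w 0 j *: f (cbase i) (cbase j).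
  rewrite [LHS](_ : _ = fR (cbase i) (\sum_j v2r w 0 j *: cbase j)).
    by rewrite linear_sum; apply: eq_bigr => j _; rewrite linearZ.
  by rewrite -cbase_sum.
rewrite scaler_sumr; apply: eq_bigr => j _.
by rewrite scalerA /tens !mxE big_ord1 !mxE.
Qed.

Lemma tens_sum V W (X : tensor V W) : X = tlift (@tens k V W) X.
Proof.
rewrite /tlift [X in LHS]matrix_sum_delta.
apply: eq_bigr => i _; apply: eq_bigr => j _; congr (_ *: _).
by rewrite /tens /cbase !r2vK trmx_delta mul_delta_mx.
Qed.

Lemma tensor_ext V W U (f g : tensor V W -> U) :
    linear f -> linear g ->
  (forall v w, f (tens v w) = g (tens v w)) -> f =1 g.
Proof.
move=> fl gl fg X.
pose f' : {linear _ -> _} := HB.pack f (GRing.isLinear.Build k _ _ _ f fl).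
pose g' : {linear _ -> _} := HB.pack g (GRing.isLinear.Build k _ _ _ g gl).
suff: f' X = g' X by [].
rewrite [X]tens_sum /tlift !linear_sum; apply: eq_bigr => i _.
rewrite !linear_sum; apply: eq_bigr => j _.
by rewrite !linearZ; congr (_ *: _); apply: fg.
Qed.

Lemma tens_eq0 V W (v : V) (w : W) :
  (tens v w == 0) = (v == 0) || (w == 0).
Proof.
have [-> | v0] := eqVneq v 0; first by rewrite /tens linear0 trmx0 mul0mx eqxx.
apply/eqP/eqP => [t0 | ->]; last exact: linear0.
apply: (can_inj v2rK); rewrite linear0; apply/rowP => j; rewrite mxE.
have [i vi] : exists i, v2r v 0 i != 0.
  apply/existsP; apply: contra_neqT v0 => /existsPn vi.
  apply: (can_inj v2rK); rewrite linear0; apply/rowP => i; rewrite mxE.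
  by apply/eqP; rewrite -[_ == _]negbK vi.
have /matrixP/(_ i j) := t0; rewrite /tens !mxE big_ord1 !mxE => /eqP.
by rewrite mulf_eq0 (negPf vi) => /eqP.
Qed.

End TensorTheory.

(* (a (x) b) (c (x) d) = ac (x) bd *)
Definition tmul (k : fieldType) (A B : falgType k) (X Y : tensor A B)
  : tensor A B :=
  tlift (fun a b => tlift (fun c d => tens (a * c) (b * d)) Y) X.

Section TensorAlgebra.
Context (k : fieldType) (A B : falgType k).
Implicit Types X Y Z : tensor A B.

Lemma tmul_linearr X : linear (tmul X).
Proof.
have E Y : tmul X Y = \sum_i \sum_j (X : 'M_(_, _)) i j *:
    tlift (fun c d => tens (cbase i * c : A) (cbase j * d : B)) Y by [].
move=> c Y Z; rewrite !E scaler_sumr -big_split; apply: eq_bigr => i _ /=.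
rewrite scaler_sumr -big_split; apply: eq_bigr => j _ /=.
by rewrite linearP scalerDr !scalerA mulrC.
Qed.

Lemma tmul_linearl Y : linear ((@tmul k A B)^~ Y).
Proof. exact: tlift_linear. Qed.

Lemma tmulE a b c d :
  tmul (tens a b) (tens c d) = tens (a * c) (b * d) :> tensor A B.
Proof.
have FE a' b' c' d' :
    tlift (fun c d => tens (a' * c : A) (b' * d : B)) (tens c' d')
      = tens (a' * c') (b' * d') :> tensor A B.
  rewrite tliftE // => [v e u w|w e u v].
    by rewrite mulrDr -scalerAr linearP.
  by rewrite mulrDr -scalerAr tensDl tensZl.
rewrite /tmul tliftE ?FE // => [v e u w|w e u v]; rewrite !FE.
  by rewrite mulrDl -scalerAl linearP.
by rewrite mulrDl -scalerAl tensDl tensZl.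
Qed.

Lemma tmulA : associative (@tmul k A B).
Proof.
move=> X Y Z.
pose l Y' e (u v : tensor A B) : tmul (e *: u + v) Y' = _ :=
  tmul_linearl Y' e u v.
pose r X' e (u v : tensor A B) : tmul X' (e *: u + v) = _ :=
  tmul_linearr X' e u v.
apply: (@tensor_ext _ _ _ _ (fun X => tmul X (tmul Y Z))
  (fun X => tmul (tmul X Y) Z)) X => [e u v|e u v|a b]; rewrite ?l //.
apply: (@tensor_ext _ _ _ _ (fun Y => tmul _ (tmul Y Z))
  (fun Y => tmul (tmul _ Y) Z)) Y => [e u v|e u v|a' b'].
- by rewrite l r.
- by rewrite r l.
apply: (@tensor_ext _ _ _ _ (fun Z => tmul _ (tmul _ Z))
  (fun Z => tmul (tmul _ _) Z)) Z => [e u v|e u v|a'' b'']; rewrite ?r //.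
by rewrite !tmulE !mulrA.
Qed.

Lemma tmul1X : left_id (tens 1 1) (@tmul k A B).
Proof.
move=> X; apply: (@tensor_ext _ _ _ _ _ id) X => // [|a b].
  exact: tmul_linearr.
by rewrite tmulE !mul1r.
Qed.

Lemma tmulX1 : right_id (tens 1 1) (@tmul k A B).
Proof.
move=> X; apply: (@tensor_ext _ _ _ _ (fun X => tmul X (tens 1 1)) id) X => //.
  exact: tmul_linearl.
by move=> a b; rewrite tmulE !mulr1.
Qed.

Lemma tmulDl : left_distributive (@tmul k A B) +%R.
Proof. by move=> X Y Z; have := tmul_linearl Z 1 X Y; rewrite !scale1r. Qed.

Lemma tmulDr : right_distributive (@tmul k A B) +%R.
Proof. by move=> X Y Z; have := tmul_linearr X 1 Y Z; rewrite !scale1r. Qed.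

Lemma tens11_neq0 : tens 1 1 != 0 :> tensor A B.
Proof. by rewrite tens_eq0 !oner_eq0. Qed.

HB.instance Definition _ := GRing.Zmodule_isNzRing.Build (tensor A B)
  tmulA tmul1X tmulX1 tmulDl tmulDr tens11_neq0.

Lemma tensM (a c : A) (b d : B) :
  tens a b * tens c d = tens (a * c) (b * d) :> tensor A B.
Proof. exact: tmulE. Qed.

Lemma tensor_scaleAl (c : k) X Y : c *: (X * Y) = c *: X * Y.
Proof.
have t0 : tmul 0 Y = 0 by exact: mul0r.
by have := tmul_linearl Y c X 0; rewrite addr0 t0 addr0.
Qed.

HB.instance Definition _ :=
  GRing.Lmodule_isLalgebra.Build k (tensor A B) tensor_scaleAl.

Lemma tensor_scaleAr (c : k) X Y : c *: (X * Y) = X * (c *: Y).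
Proof.
have t0 : tmul X 0 = 0 by exact: mulr0.
by have := tmul_linearr X c Y 0; rewrite addr0 t0 addr0.
Qed.

HB.instance Definition _ :=
  GRing.Lalgebra_isAlgebra.Build k (tensor A B) tensor_scaleAr.
HB.instance Definition _ := Algebra_isFalgebra.Build k (tensor A B).

End TensorAlgebra.

(* U (x) W as a subspace of V (x) V'. *)
Definition tensv (k : fieldType) (V V' : vectType k)
    (U : {vspace V}) (W : {vspace V'}) : {vspace tensor V V'} :=
  <<[seq tens u w | u <- vbasis U, w <- vbasis W]>>%VS.

Lemma tensv_mem (k : fieldType) (V V' : vectType k)
    (U : {vspace V}) (W : {vspace V'}) u w :
  u \in U -> w \in W -> tens u w \in tensv U W.
Proof.
move=> /coord_vbasis-> /coord_vbasis->; rewrite linear_sum.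
apply: memv_suml => j _; rewrite linearZ memvZ //=.
elim/big_rec: _ => [|i y _ ty].
  by rewrite (_ : tens _ _ = 0) ?mem0v //; apply/eqP; rewrite tens_eq0 eqxx.
rewrite tensDl tensZl memvD ?memvZ //; apply: memv_span.
by apply: allpairs_f; rewrite mem_nth ?size_tuple.
Qed.

(* The sum of a (possibly infinite) family of subspaces of V, i.e. the least  *)
(* subspace containing all of them.                                           *)
Definition sum_of_spaces (k : fieldType) (V : vectType k)
    (P : {vspace V} -> Prop) : {vspace V} :=
  xget 0%VS [set U | forall W, (U <= W)%VS <-> forall C, P C -> (C <= W)%VS].

Section SumOfSpaces.
Context (k : fieldType) (V : vectType k) (P : {vspace V} -> Prop).

Let Psum n := exists Cs : seq {vspace V},
  (forall C, C \in Cs -> P C) /\ \dim (\sum_(C <- Cs) C)%VS = n.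

Lemma finite_sum_of_spaces : exists Cs : seq {vspace V},
  (forall C, C \in Cs -> P C) /\ forall C, P C -> (C <= \sum_(C <- Cs) C)%VS.
Proof.
have exP : exists n, `[< Psum n >].
  by exists 0%N; apply/asboolP; exists [::]; split=> //; rewrite big_nil dimv0.
have ubP n : `[< Psum n >] -> (n <= \dim (fullv : {vspace V}))%N.
  by move=> /asboolP[Cs [_ <-]]; apply/dimvS/subvf.
case: (ex_maxnP exP ubP) => n /asboolP[Cs [PCs dimCs]] maxn.
exists Cs; split=> // C PC; set S := (\sum_(C <- Cs) C)%VS.
suff /eqP-> : S == (C + S)%VS by apply: addvSl.
rewrite eqEdim addvSr dimCs /=; apply: maxn; apply/asboolP.
exists (C :: Cs); split; last by rewrite big_cons.
by move=> D; rewrite inE => /predU1P[->|/PCs].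
Qed.

Lemma sum_of_spacesP W :
  (sum_of_spaces P <= W)%VS <-> forall C, P C -> (C <= W)%VS.
Proof.
rewrite /sum_of_spaces; case: xgetP => [U -> | noU] //.
have [Cs [PCs Cs_max]] := finite_sum_of_spaces.
case: (noU (\sum_(C <- Cs) C)%VS) => W'; split=> [sW C PC | CW].
  exact: subv_trans (Cs_max C PC) sW.
by rewrite big_tnth; apply/subv_sumP => i _; apply/CW/PCs/mem_tnth.
Qed.

Lemma memv_sum_of_spaces v : v \in sum_of_spaces P <->
  exists Cs : seq {vspace V},
    (forall C, C \in Cs -> P C) /\ v \in (\sum_(C <- Cs) C)%VS.
Proof.
have [Cs [PCs Cs_max]] := finite_sum_of_spaces; split=> [vS|[Ds [PDs]]].
  by exists Cs; split=> //; move: v vS; apply/subvP/sum_of_spacesP.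
apply/subvP; rewrite big_tnth; apply/subv_sumP => i _.
by have /sum_of_spacesP := subvv (sum_of_spaces P); apply; apply/PDs/mem_tnth.
Qed.

End SumOfSpaces.

HB.mixin Record Vector_isCoalgebra (k : fieldType) (C : Type)
    of Vector k C := {
  comul : {linear C -> tensor C C};
  counit : {scalar C};
  comulA : forall x : C,
    tlift (fun u v => tlift (fun v1 v2 => tens (tens u v1) v2) (comul v))
      (comul x)
    = tlift (fun u v => tens (comul u) v) (comul x);
  counitl : forall x : C, tlift (fun u v => counit u *: v) (comul x) = x;
  counitr : forall x : C, tlift (fun u v => counit v *: u) (comul x) = x
}.

#[short(type="coalgType")]
HB.structure Definition Coalgebra (k : fieldType) :=
  { C of Vector_isCoalgebra k C & Vector k C }.

HB.mixin Record Coalgebra_isBialgebra (k : fieldType) (H : Type)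
    of Falgebra k H & Coalgebra k H := {
  comul_monoid_morphism : monoid_morphism (comul : H -> tensor H H);
  counit_monoid_morphism : monoid_morphism (counit : H -> k)
}.

HB.mixin Record Bialgebra_isHopf (k : fieldType) (H : Type)
    of Falgebra k H & Coalgebra k H := {
  antipode : {linear H -> H};
  antipodel : forall x : H,
    tlift (fun u v => antipode u * v) (comul x) = counit x *: 1;
  antipoder : forall x : H,
    tlift (fun u v => u * antipode v) (comul x) = counit x *: 1
}.

#[short(type="hopfAlgType")]
HB.structure Definition HopfAlgebra (k : fieldType) :=
  { H of Falgebra k H & Coalgebra k H & Coalgebra_isBialgebra k H
         & Bialgebra_isHopf k H }.

Section Coradical.
Context (k : fieldType) (C : coalgType k).
Implicit Type D : {vspace C}.

Definition subcoalgebra D : Prop :=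
  forall x, x \in D -> comul x \in tensv D D.

Definition simple_subcoalgebra D : Prop :=
  [/\ subcoalgebra D, D <> 0%VS &
      forall E : {vspace C}, subcoalgebra E -> (E <= D)%VS ->
        E = 0%VS \/ E = D].

Definition coradical : {vspace C} := sum_of_spaces simple_subcoalgebra.

Definition coradical1 : {vspace C} :=
  (linfun comul @^-1: (tensv fullv coradical + tensv coradical fullv))%VS.

Definition pointed : Prop :=
  forall D, simple_subcoalgebra D -> \dim D = 1%N.

End Coradical.

Arguments coradical {k} C.
Arguments coradical1 {k} C.
Arguments pointed {k} C.

Section Rank.
Context (k : fieldType) (H : hopfAlgType k).

(* The relations (1 . h) (x) v = 1 (x) (h v), for h in H_0 and v in H_1, that *)
(* define k (x)_{H_0} H_1 as a quotient of k (x) H_1; here 1 . h = counit h.  *)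
Definition balanced_relations : {vspace tensor k^o H} :=
  <<[seq tens (counit h : k^o) v - tens (1 : k^o) (h * v)
      | h : H <- vbasis (coradical H), v : H <- vbasis (coradical1 H)]>>%VS.

Lemma balanced_relationsP (c : k^o) (h v : H) :
    h \in coradical H -> v \in coradical1 H ->
  tens (c * counit h : k^o) v - tens c (h * v) \in balanced_relations.
Proof.
have rD e d (u w : H) : tens d (e *: u + w) = e *: tens d u + tens d w
  :> tensor k^o H by rewrite linearP.
have lD e d d' (u : H) : tens (e * d + d' : k^o) u = e *: tens d u + tens d' u
  :> tensor k^o H by rewrite tensDl -tensZl.
pose rel (h v : H) : tensor k^o H :=
  tens (counit h : k^o) v - tens (1 : k^o) (h * v).
have relDl e h1 h2 w : rel (e *: h1 + h2) w = e *: rel h1 w + rel h2 w.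
  rewrite /rel linearP lD mulrDl -scalerAl rD scalerBr opprD.
  by rewrite addrACA.
have relDr e g w1 w2 : rel g (e *: w1 + w2) = e *: rel g w1 + rel g w2.
  by rewrite /rel rD mulrDr -scalerAr rD scalerBr opprD addrACA.
move=> hH0 vH1; rewrite (_ : _ - _ = c *: rel h v); last first.
  by rewrite /rel scalerBr -!tensZl /GRing.scale /= mulr1.
have rel0l w : rel 0 w = 0.
  by have := relDl (-1) 0 0 w; rewrite scaler0 addr0 scaleN1r addNr.
have rel0r g : rel g 0 = 0.
  by have := relDr (-1) g 0 0; rewrite scaler0 addr0 scaleN1r addNr.
apply: memvZ; rewrite (coord_vbasis hH0) (coord_vbasis vH1).
elim/big_rec: _ => [|i h' _ IHh]; first by rewrite rel0l mem0v.
rewrite relDl memvD // memvZ //.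
elim/big_rec: _ => [|j v' _ IHv]; first by rewrite rel0r mem0v.
rewrite relDr memvD // memvZ //; apply: memv_span.
by apply: (allpairs_f rel); rewrite mem_nth ?size_tuple.
Qed.

(* \dim (U :\: W) is the dimension of the quotient of U by U :&: W. *)
Definition dim_triv_tensor_coradical1 : nat :=
  \dim (tensv (fullv : {vspace k^o}) (coradical1 H) :\: balanced_relations)%VS.

Definition has_rank (t : nat) : Prop :=
  pointed H /\ dim_triv_tensor_coradical1 = t.+1.

End Rank.

Arguments has_rank {k} H t.

(* The basis vector g of kG. *)
Definition kG_elt (k : fieldType) (G : finGroupType) (g : G)
  : {ffun G -> k^o} :=
  [ffun h => (h == g)%:R].

(* alphaN1 is alpha_{-1}, and N is the order of chi(a). *)
Record datumR (k : fieldType) (p : nat) := DatumR {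
  R_G : finGroupType;
  R_chi : R_G -> k;
  R_a : R_G;
  R_r : nat;
  R_alphaN1 : k;
  R_alpha : 'I_R_r -> k;
  R_N : nat;
  R_aZ : R_a \in 'Z([set: R_G])%g;
  R_chi_neq0 : forall g, R_chi g != 0;
  R_chiM : forall g h, R_chi (g * h)%g = R_chi g * R_chi h;
  R_chia : R_chi R_a != 1;
  R_N_order : R_N.-primitive_root (R_chi R_a);
  R_alphaN1_eq0 : (R_a ^+ (p ^ R_r * R_N))%g = 1%g -> R_alphaN1 = 0;
  R_alpha_cond : forall i : 'I_R_r, R_alpha i != 0 ->
    (R_a ^+ (R_N * (p ^ R_r - p ^ i)))%g = 1%g /\
    forall g, R_chi g ^+ (R_N * (p ^ R_r - p ^ i)) = 1;
  R_alphaN1_cond : R_alphaN1 != 0 -> forall g, R_chi g ^+ (R_N * p ^ R_r) = 1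
}.

Arguments R_chi {k p} d g : rename.
Arguments R_alpha {k p} d i : rename.

Definition R_n (k : fieldType) (p : nat) (R : datumR k p) : nat :=
  (p ^ R_r R * R_N R)%N.

(* The m%:R with m : 'F_p are the elements of the prime field of k. *)
Record datumF (k : fieldType) (p : nat) := DatumF {
  F_G : finGroupType;
  F_chi : F_G -> k;
  F_c : F_G -> k;
  F_a : F_G;
  F_alphaN1 : k;
  F_alpha0 : k;
  F_aZ : F_a \in 'Z([set: F_G])%g;
  F_chi_neq0 : forall g, F_chi g != 0;
  F_chiM : forall g h, F_chi (g * h)%g = F_chi g * F_chi h;
  F_chia : F_chi F_a = 1;
  F_c_cocycle : forall g h, F_c (h * g)%g = F_chi g * F_c h + F_c g;
  F_ca : F_c F_a = 0;
  F_alpha0_01 : F_alpha0 = 0 \/ F_alpha0 = 1;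
  F_alphaN1_eq0 : F_alpha0 = 0 -> F_alphaN1 = 0;
  F_cond0 : F_alpha0 = 0 -> forall g,
    F_c g *: (kG_elt k (F_a ^+ p)%g - kG_elt k 1%g) = 0;
  F_cond1 : F_alpha0 = 1 ->
    (F_a ^+ p)%g = F_a /\
    forall g,
      (exists2 m : 'F_p, m != 0 & F_chi g = m%:R) /\
      (F_alphaN1 * (F_chi g - 1) + F_c g ^+ p - F_c g)
        *: (kG_elt k F_a - kG_elt k 1%g) = 0
}.

Arguments F_chi {k p} d g : rename.
Arguments F_c {k p} d g : rename.

(* The part common to H_R and H_F: H contains x and kG, the latter embedded   *)
(* by iota, which is injective because the g x^0 belong to the basis.         *)
Definition hopf_on_basis (k : fieldType) (G : finGroupType) (H : hopfAlgType k)
    (iota : G -> H) (x : H) (a : G) (n : nat) : Prop :=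
  [/\ iota 1%g = 1,
      forall g h, iota (g * h)%g = iota g * iota h &
      basis_of fullv [seq iota u.1 * x ^+ u.2 | u : G * 'I_n]] /\
  forall g (i : 'I_n),
  [/\ comul (iota g * x ^+ i)
        = tens (iota g) (iota g) * (tens x (iota a) + tens 1 x) ^+ i,
      counit (iota g * x ^+ i) = (i == 0%N :> nat)%:R &
      antipode (iota g * x ^+ i) = (- x * iota a^-1%g) ^+ i * iota g^-1%g].

Definition is_HR (k : fieldType) (p : nat) (R : datumR k p)
    (H : hopfAlgType k) : Prop :=
  exists (iota : R_G R -> H) (x : H),
  [/\ hopf_on_basis iota x (R_a R) (R_n R),
      forall g, iota g * x * iota g^-1%g = R_chi R g *: x &
      x ^+ R_n R = R_alphaN1 R *: (iota (R_a R) ^+ R_n R - 1)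
        + \sum_(i < R_r R) R_alpha R i *: x ^+ (p ^ i * R_N R)].

Definition is_HF (k : fieldType) (p : nat) (F : datumF k p)
    (H : hopfAlgType k) : Prop :=
  exists (iota : F_G F -> H) (x : H),
  [/\ hopf_on_basis iota x (F_a F) p,
      forall g, iota g * x * iota g^-1%g
        = F_chi F g *: x + F_c F g *: (iota (F_a F) - 1) &
      x ^+ p = F_alphaN1 F *: (iota (F_a F) ^+ p - 1) + F_alpha0 F *: x].

(* Main.v *)
From HB Require Import structures.
Require Import Defs.
From mathcomp Require Import all_boot all_order all_algebra all_fingroup.
From mathcomp Require Import all_solvable all_field.
From mathcomp Require Import zify.
Set Implicit Arguments.
Unset Strict Implicit.
Unset Printing Implicit Defensive.
Import GRing.Theory.
Local Open Scope ring_scope.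

(** In both families H has the basis g x^i (g in G, i < n), x is
    skew-primitive, and x a = u a x with u = chi(a)^-1 for H_R and u = 1 for
    H_F.  As 1 (x) x and x (x) a then commute up to u, the Gaussian binomial
    theorem [skew_exprDn] gives [comul_monomial]:

      Delta (g x^i) = sum_(j <= i) [i, j]_u  g x^j (x) g a^j x^(i-j).

    The tensors on the right are tensors of two basis vectors, and the pair
    (g x^j, g a^j x^(i-j)) determines (g, i, j).  So the expansion of Delta h
    in the tensor basis is that of h, scaled by Gaussian binomials, and no
    cancellation can occur ([dual_slice_comul]).

    Pointedness.  A subcoalgebra D is stable under contracting one tensor
    factor of Delta with a linear form.  Take d <> 0 in D, and let g x^m be a
    monomial of d whose degree m in x is maximal; contracting the second factor
    of Delta d with the coordinate form of g x^m leaves a nonzero multiple of g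
    ([subcoalgebra_has_grouplike]).  Hence the simple subcoalgebras are the
    lines k g, and H_0 = k G.

    Rank.  Now H (x) H_0 + H_0 (x) H is spanned by the basis tensors with a
    factor of degree 0.  Therefore H_1 is spanned by the g x^i for which i is in
    the set S of the i < n with [i, j]_u = 0 whenever 0 < j < i
    ([coradical1_dualP]).  It is a free k G-module on the x^i with i in S, so
    that k (x)_(H_0) H_1 has dimension #|S| ([dim_triv_tensor_coradical1E]).

    It remains to find S.  It always contains 0 and 1, so rank one means that S
    has no element above 1.  An i > 1 with [i, 1]_u <> 0 is not in S, where
    [i, 1]_u = 1 + u + ... + u^(i-1).  For H_F this is i, which is nonzero in k
    for 0 < i < p.  For H_R with r = 0 it is (1 - u^i) / (1 - u), which is
    nonzero for 0 < i < N = n since u has order N.  For H_R with r > 0, all the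
    [N, j]_u with 0 < j < N vanish, so that N, which satisfies 1 < N < n, is in
    S. *)

(** * Gaussian binomials and the skew binomial theorem *)

(** The Gaussian binomial [i, j]_u, by the Pascal rule that multiplying
    (X + Y)^i by X + Y on the left produces when Y X = u X Y. *)
Fixpoint gbin (R : comNzRingType) (u : R) (i j : nat) : R :=
  match i, j with
  | _, 0%N => 1
  | 0%N, _.+1 => 0
  | i'.+1, j'.+1 => gbin u i' j' + u ^+ j * gbin u i' j
  end.

Section GaussianBinomial.
Context (R : comNzRingType).
Implicit Types (u : R) (i j : nat).

Lemma gbin0 u i : gbin u i 0 = 1. Proof. by case: i. Qed.

Lemma gbinS u i j :
  gbin u i.+1 j.+1 = gbin u i j + u ^+ j.+1 * gbin u i j.+1.
Proof. by []. Qed.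

Lemma gbin_small u i j : (i < j)%N -> gbin u i j = 0.
Proof.
elim: i j => [|i IH] [|j] //; rewrite ltnS gbinS => ij.
by rewrite !IH ?mulr0 ?addr0 // ltnW.
Qed.

(** The ratio of two neighbours in a row of the Gaussian Pascal triangle,
    cleared of denominators.  It gives both the value of [i, 1]_u and the
    vanishing of [N, j]_u at a root of unity of order N.  Truncated
    subtraction is harmless: for i < j both sides vanish. *)
Lemma gbin_mul_right u i j :
  (1 - u ^+ j.+1) * gbin u i j.+1 = (1 - u ^+ (i - j)) * gbin u i j.
Proof.
elim: i j => [|i IH] j; first by rewrite subrr mul0r mulr0.
have [lt_ij|le_ji] := ltnP i j.
  by rewrite gbin_small // (eqP lt_ij) subrr mul0r mulr0.
have -> : (1 - u ^+ j.+1) * gbin u i.+1 j.+1 = (1 - u ^+ i.+1) * gbin u i j.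
  rewrite gbinS mulrDr mulrCA IH mulrA -mulrDl mulrBr mulr1 -exprD.
  by rewrite addSn subnKC // addrA subrK.
case: j le_ji => [|j] lt_ji; first by rewrite !gbin0 subn0.
rewrite gbinS mulrDr subSS -IH mulrCA mulrA -mulrDl mulrBr mulr1 -exprD.
by rewrite addSn subnKC ?(ltnW lt_ji) // addrA subrK.
Qed.

Lemma gbin_1q i : gbin 1 i 1 = i%:R :> R.
Proof.
by elim: i => // i IH; rewrite gbinS IH gbin0 expr1 mul1r -[i.+1]add1n natrD.
Qed.

End GaussianBinomial.

(** Along row N the factor 1 - u^(N - j) of the ratio vanishes at j = 0, while
    the factors 1 - u^(j + 1) stay invertible for j + 1 < N; so the zero at
    j = 1 propagates up to j = N - 1. *)
Lemma gbin_prim_root (k : fieldType) (u : k) N j :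
  N.-primitive_root u -> (0 < j < N)%N -> gbin u N j = 0.
Proof.
move=> uN; elim: j => // j IH lt_jN.
have uj : 1 - u ^+ j.+1 != 0.
  by rewrite subr_eq0 eq_sym -(prim_order_dvd uN) gtnNdvd.
apply: (mulfI uj); rewrite mulr0 gbin_mul_right.
case: j IH lt_jN {uj} => [|j] IH lt_jN.
  by rewrite subn0 prim_expr_order // subrr mul0r.
by rewrite IH ?mulr0 //=; apply: ltnW.
Qed.

Lemma gbin1_neq0 (k : fieldType) (u : k) N i :
  N.-primitive_root u -> (0 < i < N)%N -> gbin u i 1 != 0.
Proof.
move=> uN /andP[i0 iN]; apply/eqP => ui0.
have := gbin_mul_right u i 0; rewrite ui0 gbin0 mulr0 mulr1 subn0.
by apply/eqP; rewrite eq_sym subr_eq0 eq_sym -(prim_order_dvd uN) gtnNdvd.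
Qed.

Lemma skew_exprDn (k : fieldType) (A : algType k) (u : k) (X Y : A) i :
  Y * X = u *: (X * Y) ->
  (X + Y) ^+ i = \sum_(j < i.+1) gbin u i j *: (X ^+ j * Y ^+ (i - j)).
Proof.
move=> YX.
have YXj j : Y * X ^+ j = u ^+ j *: (X ^+ j * Y).
  elim: j => [|j IH]; first by rewrite !expr0 mulr1 mul1r scale1r.
  rewrite [in LHS]exprS mulrA YX -scalerAl -[X * Y * _]mulrA IH -scalerAr.
  by rewrite scalerA -exprS mulrA -exprS.
elim: i => [|i IH]; first by rewrite big_ord1 gbin0 scale1r mulr1.
rewrite exprS IH mulrDl !mulr_sumr.
rewrite [in RHS]big_ord_recl gbin0 scale1r mul1r subn0.
rewrite [X in _ + X = _]big_ord_recl gbin0 !scale1r !expr0 !mul1r subn0 -exprS.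
rewrite addrCA; congr (_ + _).
under [RHS]eq_bigr => j _ do rewrite lift0 gbinS subSS scalerDl.
rewrite big_split /=; congr (_ + _).
  by apply: eq_bigr => j _; rewrite -scalerAr mulrA -exprS.
rewrite [RHS]big_ord_recr /= gbin_small // mulr0 scale0r addr0.
apply: eq_bigr => j _; rewrite /bump add1n -scalerAr mulrA YXj -scalerAl.
by rewrite scalerA -mulrA -exprS mulrC subnSK.
Qed.

(** * Coordinates in a tensor square *)

Section DualBasis.
Context (k : fieldType) (V : vectType k) (T : finType) (e : T -> V).
Context (e_basis : basis_of fullv [seq e t | t : T]).

Definition dual t : V -> k := coord (codom_tuple e) (enum_rank t).

HB.instance Definition _ t :=
  GRing.Linear.copy (dual t) (coord (codom_tuple e) (enum_rank t)).

Lemma dualE t t' : dual t (e t') = (t == t')%:R.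
Proof.
have e_free := basis_free (e_basis : basis_of _ (codom_tuple e)).
have := coord_free (enum_rank t') (enum_rank t) e_free.
rewrite (inj_eq enum_rank_inj) eq_sym => <-; congr (coord _ _ _).
by rewrite (nth_codom _ e) enum_rankK.
Qed.

Lemma dual_sum v : v = \sum_t dual t v *: e t.
Proof.
rewrite [LHS](coord_basis (e_basis : basis_of _ (codom_tuple e)) (memvf v)).
rewrite (reindex (@enum_rank T)) /=; last first.
  by exists enum_val => t _; rewrite ?enum_rankK ?enum_valK.
by apply: eq_bigr => t _; rewrite (nth_codom _ e) enum_rankK.
Qed.

Lemma dual_ext v w : (forall t, dual t v = dual t w) -> v = w.
Proof.
by move=> E; rewrite [v]dual_sum [w]dual_sum; apply: eq_bigr => t _; rewrite E.
Qed.

(** Contraction of the second tensor factor with the coordinate form [dual t];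
    [dual s (slice t X)] is thus the coordinate of X on e s (x) e t. *)
Definition slice t : tensor V V -> V :=
  tlift (fun v w => dual t w *: v).

HB.instance Definition _ t :=
  GRing.Linear.copy (slice t) (tlift (fun v w => dual t w *: v)).

Lemma sliceE t v w : slice t (tens v w) = dual t w *: v.
Proof.
apply: (@tliftE _ _ _ _ (fun v w => dual t w *: v)) => [u c y z|u c y z].
  by rewrite linearP scalerDl scalerA.
by rewrite scalerDr !scalerA mulrC.
Qed.

(** The form in which the subcoalgebra condition is exploited: a subcoalgebra
    is stable under the slices of its coproducts. *)
Lemma slice_tensv t (U W : {vspace V}) X : X \in tensv U W -> slice t X \in U.
Proof.
move=> XU; rewrite -[slice t X](lfunE (slice t)) memv_preim.
apply: subvP XU; apply/span_subvP => _ /allpairsP[[u w] [/= Uu _ ->]].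
by rewrite -memv_preim lfunE /= sliceE memvZ // vbasis_mem.
Qed.

Lemma tens_basis_sum X :
  X = \sum_t \sum_s dual t (slice s X) *: tens (e t) (e s).
Proof.
apply: (@tensor_ext _ _ _ _ id (fun X => \sum_t \sum_s
   dual t (slice s X) *: tens (e t) (e s))) X => // [c X Y|v w].
  rewrite scaler_sumr -big_split; apply: eq_bigr => t _ /=.
  rewrite scaler_sumr -big_split; apply: eq_bigr => s _ /=.
  by rewrite !linearP /= scalerDl scalerA.
transitivity (tens (\sum_t dual t v *: e t) (\sum_s dual s w *: e s)).
  by rewrite -!dual_sum.
rewrite (_ : tens _ _ = \sum_t dual t v *: tens (e t) (\sum_s dual s w *: e s)).
  apply: eq_bigr => t _; rewrite linear_sum scaler_sumr.
  apply: eq_bigr => s _; rewrite linearZ scalerA sliceE linearZ /=.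
  by rewrite mulrC.
set W := \sum_s dual s w *: e s.
elim/big_rec2: _ => [|t y z _ <-]; last by rewrite tensDl tensZl.
by apply/eqP; rewrite tens_eq0 eqxx.
Qed.

End DualBasis.

(** * The unit isomorphism of the tensor product *)

Section ScalarTensor.
Context (k : fieldType) (V : vectType k).
Implicit Types (c : k^o) (v : V).

Definition tensor_unitor : tensor k^o V -> V :=
  tlift (fun c v => (c : k) *: v).

HB.instance Definition _ := GRing.Linear.copy tensor_unitor
  (tlift (fun (c : k^o) (v : V) => (c : k) *: v)).

Lemma tensor_unitorE c v : tensor_unitor (tens c v) = (c : k) *: v.
Proof.
apply: (@tliftE _ _ _ _ (fun c v => (c : k) *: v)) => [b d y z|y d b b'].
  by rewrite scalerDr !scalerA mulrC.
by rewrite scalerDl scalerA.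
Qed.

Lemma tens1_unitor (X : tensor k^o V) :
  X = tens (1 : k^o) (tensor_unitor X).
Proof.
apply: (@tensor_ext _ _ _ _ id
  (fun X => tens (1 : k^o) (tensor_unitor X))) X => //.
  by move=> c X Y; rewrite !linearP.
by move=> c v; rewrite tensor_unitorE linearZ /= -tensZl /GRing.scale /= mulr1.
Qed.

End ScalarTensor.

(** * Hopf algebras on monomials in a skew-primitive element *)

(** A Gaussian binomial [i, j]_u is the coefficient in Delta(x^i) of a basis
    tensor whose factors have degrees j and i - j.  Their joint vanishing for
    0 < j < i says that both factors never have positive degree together, which
    is what puts x^i in the first term of the coradical filtration. *)
Definition coradical1_degrees (k : fieldType) (n : nat) (u : k) : {set 'I_n} :=
  [set i : 'I_n | [forall j : 'I_n, (0 < j < i)%N ==> (gbin u i j == 0)]].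

Section SkewPrimitive.
Context (k : fieldType) (G : finGroupType) (H : hopfAlgType k).
Context (iota : G -> H) (x : H) (a : G) (n : nat) (u : k).
Context (H_basis : hopf_on_basis iota x a n) (n_gt0 : (0 < n)%N).
Context (xa : x * iota a = u *: (iota a * x)).
Implicit Types (g : G) (s t w : G * 'I_n) (v : H) (D : {vspace H}).

Let e w : H := iota w.1 * x ^+ w.2.
Let deg0 : 'I_n := Ordinal n_gt0.
Let S := coradical1_degrees n u.

Let e_basis : basis_of fullv [seq e w | w : G * 'I_n].
Proof. by case: H_basis => -[]. Qed.

Let pairE s g i : (s == (g, i)) = (s.1 == g) && (s.2 == i).
Proof. by case: s. Qed.

Let iota1 : iota 1%g = 1.
Proof. by case: H_basis => -[]. Qed.

Let iotaM g g' : iota (g * g')%g = iota g * iota g'.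
Proof. by case: H_basis => -[]. Qed.

Let iotaX g i : iota (g ^+ i)%g = iota g ^+ i.
Proof.
elim: i => [|i IH]; first by rewrite expg0 expr0 iota1.
by rewrite expgS exprS iotaM IH.
Qed.

Let iotaE g : iota g = e (g, deg0).
Proof. by rewrite /e /= expr0 mulr1. Qed.

Let counit_iota g : counit (iota g) = 1.
Proof. by case: H_basis => _ /(_ g deg0)[_]; rewrite expr0 mulr1. Qed.

Let comul_iota g : comul (iota g) = tens (iota g) (iota g).
Proof. by case: H_basis => _ /(_ g deg0)[+ _ _]; rewrite !expr0 !mulr1. Qed.

Lemma comul_monomial w :
  comul (e w) = \sum_(j < w.2.+1) gbin u w.2 j *:
    tens (iota w.1 * x ^+ j) (iota (w.1 * a ^+ j)%g * x ^+ (w.2 - j)).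
Proof.
have XE i : tens x (iota a) ^+ i = tens (x ^+ i) (iota a ^+ i) :> tensor H H.
  by elim: i => // i IH; rewrite !exprS IH tensM.
have YE i : tens 1 x ^+ i = tens 1 (x ^+ i) :> tensor H H.
  by elim: i => // i IH; rewrite !exprS IH tensM mulr1.
case: H_basis => _ /(_ w.1 w.2)[-> _ _]; rewrite (@skew_exprDn _ _ u).
  rewrite mulr_sumr; apply: eq_bigr => j _; rewrite -scalerAr XE YE !tensM.
  by rewrite mulr1 iotaM iotaX mulrA.
by rewrite !tensM mul1r mulr1 xa linearZ.
Qed.

Lemma dual_monomial s g i : (i < n)%N ->
  dual e s (iota g * x ^+ i) = ((s.1 == g) && (s.2 == i :> nat))%:R.
Proof.
by move=> lt_in; have := dualE e_basis s (g, Ordinal lt_in); rewrite pairE.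
Qed.

Lemma dual_slice_monomial s t w : dual e s (slice e t (comul (e w))) =
  if [&& w.1 == s.1, t.1 == (s.1 * a ^+ s.2)%g & w.2 == (s.2 + t.2)%N :> nat]
  then gbin u w.2 s.2 else 0.
Proof.
have -> : dual e s (slice e t (comul (e w))) =
    \sum_(j < w.2.+1 | s.2 == j :> nat) gbin u w.2 j *
      [&& w.1 == s.1, t.1 == (s.1 * a ^+ j)%g & w.2 == (j + t.2)%N :> nat]%:R.
  rewrite comul_monomial [slice _ _ _]linear_sum linear_sum.
  rewrite [RHS]big_mkcond; apply: eq_bigr => j _ /=.
  have le_jw : (j <= w.2)%N by rewrite -ltnS.
  rewrite !linearZ /= sliceE // linearZ /= !dual_monomial; first last.
  - by apply: leq_ltn_trans (ltn_ord w.2); apply: leq_subr.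
  - by apply: leq_ltn_trans (ltn_ord w.2).
  have [_|_] := eqVneq (s.2 : nat) j; last by rewrite andbF !mulr0.
  rewrite andbT -natrM mulnb andbC [s.1 == _]eq_sym; case: eqP => [->|] //=.
  by congr (_ * (_ && _)%:R); lia.
have [lt_sw|lt_ws] := ltnP s.2 w.2.+1.
  rewrite (big_pred1 (Ordinal lt_sw)) /=; last by move=> j; rewrite eq_sym.
  by case: ifP; rewrite ?mulr1 ?mulr0.
rewrite big_pred0 => [|j]; last by apply/eqP; case: j => j /= lt_j; lia.
case: and3P => // -[_ _ /eqP w2]; lia.
Qed.

(** The index set has at most one element, namely w = (s.1, s.2 + t.2): each
    coordinate of [comul v] is a Gaussian binomial times one coordinate of v.
    The sum only avoids a case distinction on s.2 + t.2 < n. *)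
Lemma dual_slice_comul s t v : dual e s (slice e t (comul v)) =
  \sum_(w : G * 'I_n | [&& w.1 == s.1, t.1 == (s.1 * a ^+ s.2)%g
              & w.2 == (s.2 + t.2)%N :> nat]) dual e w v * gbin u w.2 s.2.
Proof.
rewrite {1}(dual_sum e_basis v) [comul _]linear_sum [slice _ _ _]linear_sum.
rewrite linear_sum [RHS]big_mkcond; apply: eq_bigr => w _.
rewrite !linearZ /= dual_slice_monomial.
by case: ifP; rewrite // mulr0.
Qed.

(** Slicing the coproduct of d in D at a monomial t of d of maximal degree
    leaves only the term with first factor of degree 0, because every other
    term would come from a monomial of d of larger degree. *)
Lemma subcoalgebra_has_grouplike D :
  subcoalgebra D -> D <> 0%VS -> exists g, iota g \in D.
Proof.
move=> Dsub D0; pose d := vpick D.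
have [w1 dw1] : exists w, dual e w d != 0.
  apply/existsP; apply: contra_notT D0 => /existsPn d0; apply/eqP.
  rewrite -vpick0; apply/eqP/(dual_ext e_basis) => w.
  by rewrite linear0; apply/eqP; rewrite -[_ == _]negbK d0.
pose supp w := dual e w d != 0.
case: (@arg_maxnP _ w1 supp (fun w => w.2)) => // t dt max_t.
exists t.1; have := Dsub _ (memv_pick D) => /(slice_tensv e t).
suff -> : slice e t (comul (vpick D)) = dual e t d *: iota t.1.
  by rewrite rpredZeq // (negPf dt).
apply: (dual_ext e_basis) => s; rewrite dual_slice_comul.
rewrite linearZ iotaE /= (dualE e_basis).
rewrite (bigID (pred1 t)) /= [X in _ + X]big1 => [|w]; last first.
  move=> /andP[/and3P[/eqP w1s /eqP t1s /eqP w2] neq_wt].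
  have [->|/max_t le_wt] := eqVneq (dual e w d) 0; first by rewrite mul0r.
  case/eqP: neq_wt; have s2 : s.2 = 0%N :> nat by move: le_wt => /=; lia.
  case: w t {max_t dt} w1s t1s w2 le_wt => wg wi [tg ti] /= -> -> w2 le_wt.
  by rewrite s2 expg0 mulg1; congr (_, _); apply: val_inj => /=; lia.
rewrite addr0; have [->|] := eqVneq s (t.1, deg0).
  rewrite mulr1 (big_pred1 t) /= ?gbin0 ?mulr1 // => w.
  rewrite /=; have [->|_] := eqVneq w t; last by rewrite andbF.
  by rewrite expg0 mulg1 !eqxx.
rewrite mulr0 => neq_s; rewrite big1 // => w /andP[/and3P[/eqP ws tE /eqP w2]].
move=> /eqP wt; case/eqP: neq_s; rewrite wt in ws w2.
case: s ws w2 {tE} => sg si /= <- w2.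
by congr (_, _); apply: val_inj => /=; lia.
Qed.

Lemma iota_neq0 g : iota g != 0.
Proof.
apply/eqP => g0; have := counit_iota g; rewrite g0 linear0 => /esym/eqP.
by rewrite oner_eq0.
Qed.

Lemma simple_iota g : simple_subcoalgebra <[iota g]>%VS.
Proof.
split=> [v /vlineP[c ->] | /eqP | E _ Eg].
- by rewrite linearZ memvZ //= comul_iota tensv_mem ?memv_line.
- by rewrite -dimv_eq0 dim_vline iota_neq0.
have [->|E0] := eqVneq E 0%VS; [by left | right]; apply/eqP.
by rewrite eqEdim Eg dim_vline iota_neq0 lt0n dimv_eq0.
Qed.

Lemma simple_subcoalgebraP D :
  simple_subcoalgebra D -> exists g, D = <[iota g]>%VS.
Proof.
case=> Dsub D0 Dmin; have [g Dg] := subcoalgebra_has_grouplike Dsub D0.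
exists g; have [gsub g0 _] := simple_iota g.
by case: (Dmin _ gsub) => // [|<-] //; rewrite -memvE.
Qed.

Lemma pointed_skew : pointed H.
Proof.
by move=> D /simple_subcoalgebraP[g ->]; rewrite dim_vline iota_neq0.
Qed.

Lemma iota_coradical g : iota g \in coradical H.
Proof.
have /sum_of_spacesP cor := subvv (coradical H).
by rewrite memvE; apply/cor/simple_iota.
Qed.

Lemma dual_coradical v w : v \in coradical H -> (0 < w.2)%N -> dual e w v = 0.
Proof.
move=> vH0 w0; suff: (coradical H <= lker (linfun (dual e w : H -> k^o)))%VS.
  by move=> /subvP/(_ v vH0); rewrite memv_ker lfunE => /eqP.
apply/sum_of_spacesP => D /simple_subcoalgebraP[g ->].
rewrite -memvE memv_ker lfunE /= iotaE (dualE e_basis).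
by have [w_g|//] := eqVneq w (g, deg0); rewrite w_g in w0.
Qed.

Lemma coradical_sum v : v \in coradical H ->
  v = \sum_g dual e (g, deg0) v *: iota g.
Proof.
move=> vH0; apply: (dual_ext e_basis) => w; rewrite linear_sum /=.
have [/eqP w0|w0] := posnP w.2; last first.
  rewrite dual_coradical // big1 // => g _; rewrite linearZ iotaE /=.
  by rewrite (dualE e_basis); case: eqP w0 => [->|] //; rewrite mulr0.
rewrite (bigD1 w.1) //= big1 => [|g /negPf gw].
  rewrite addr0 linearZ iotaE /= (_ : (w.1, deg0) = w).
    by rewrite (dualE e_basis) eqxx mulr1.
  by case: w w0 => g i /eqP i0; congr (_, _); apply: val_inj.
rewrite linearZ iotaE /= (dualE e_basis) pairE /= eq_sym gw.
by rewrite mulr0.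
Qed.

(** Without cancellation among the coordinates of [comul v], v lies in H_1
    exactly when each of its monomials does. *)
Lemma coradical1_dualP v : v \in coradical1 H <->
  forall w, w.2 \notin S -> dual e w v = 0.
Proof.
(* H (x) H_0 + H_0 (x) H consists of the tensors whose coordinates on the *)
(* basis tensors with both factors of positive degree vanish. *)
transitivity (forall s t, (0 < s.2)%N -> (0 < t.2)%N ->
    dual e s (slice e t (comul v)) = 0); last split.
- rewrite /coradical1 -memv_preim lfunE /=; split=> [vH1 s t s0 t0|v0].
    pose f := linfun (dual e s \o slice e t : tensor H H -> k^o).
    suff: (tensv fullv (coradical H) + tensv (coradical H) fullv <= lker f)%VS.
      by move=> /subvP/(_ _ vH1); rewrite memv_ker lfunE => /eqP.
    rewrite subv_add; apply/andP.
    split; apply/span_subvP => _ /allpairsP[[v1 v2] [/= v1P v2P ->]];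
      rewrite memv_ker lfunE /= sliceE // linearZ /=.
      by rewrite (dual_coradical (vbasis_mem v2P)) // mul0r.
    by rewrite (dual_coradical (vbasis_mem v1P)) // mulr0.
  rewrite [comul v](tens_basis_sum e_basis).
  apply: memv_suml => s _; apply: memv_suml => t _; case: (posnP s.2) => s0.
    apply/memvZ/(subvP (addvSr _ _))/tensv_mem; last exact: memvf.
    by rewrite /e s0 expr0 mulr1 iota_coradical.
  case: (posnP t.2) => t0; last by rewrite v0 // scale0r mem0v.
  apply/memvZ/(subvP (addvSl _ _))/tensv_mem; first exact: memvf.
  by rewrite /e t0 expr0 mulr1 iota_coradical.
- move=> v0 w; rewrite inE negb_forall => /existsP[j].
  rewrite negb_imply => /andP[/andP[j0 lt_jw] bj].
  have lt_n : (w.2 - j < n)%N.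
    by apply: leq_ltn_trans (ltn_ord w.2); apply: leq_subr.
  have := v0 (w.1, j) ((w.1 * a ^+ j)%g, Ordinal lt_n) j0.
  rewrite /= subn_gt0 => /(_ lt_jw); rewrite dual_slice_comul (big_pred1 w) /=.
    by move/eqP; rewrite mulf_eq0 (negPf bj) orbF => /eqP.
  by case=> g i /=; rewrite eqxx subnKC ?(ltnW lt_jw) // -[w]surjective_pairing.
move=> v0 s t s0 t0; rewrite dual_slice_comul big1 // => w.
move=> /and3P[_ _ /eqP w2].
have [wS|/v0->] := boolP (w.2 \in S); last by rewrite mul0r.
move: wS; rewrite inE => /forallP/(_ s.2)/implyP b0.
have /b0/eqP-> : (0 < s.2 < w.2)%N.
  by rewrite s0 w2 -{1}[s.2 : nat]addn0 ltn_add2l.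
exact: mulr0.
Qed.

(** * The dimension of k (x)_(H_0) H_1 *)

Lemma dual_iota_mul g w v :
  dual e w (iota g * v) = dual e ((g^-1 * w.1)%g, w.2) v.
Proof.
rewrite {1}(dual_sum e_basis v) mulr_sumr linear_sum.
rewrite (bigD1 ((g^-1 * w.1)%g, w.2)) //= big1 => [|s neq_s].
  rewrite addr0 -scalerAr linearZ /= mulrA -iotaM mulKVg.
  by rewrite dual_monomial // !eqxx mulr1.
rewrite -scalerAr linearZ /= mulrA -iotaM dual_monomial //.
case: andP => [[/eqP w1 /eqP w2]|]; last by rewrite mulr0.
case/eqP: neq_s; rewrite w1 mulKg; case: s w1 w2 => sg si /= _ w2.
by congr (_, _); apply: val_inj.
Qed.

(** The linear forms on H_1 invariant under G are spanned by the sums of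
    coordinates over the orbits of G on the monomials, one orbit for each
    degree in S.  Together they induce the isomorphism of k (x)_(k G) H_1 with
    k^S. *)
Definition orbit_sums v : 'rV[k]_#|S| :=
  \row_(i < #|S|) \sum_g dual e (g, enum_val i) v.

Lemma orbit_sums_linear : linear orbit_sums.
Proof.
move=> c v v'; apply/rowP => i; rewrite !mxE mulr_sumr -big_split.
by apply: eq_bigr => g _; rewrite linearP.
Qed.

HB.instance Definition _ :=
  GRing.isLinear.Build k H 'rV[k]_#|S| _ orbit_sums orbit_sums_linear.

Lemma orbit_sums_iota g v : orbit_sums (iota g * v) = orbit_sums v.
Proof.
apply/rowP => i; rewrite !mxE (reindex_inj (mulgI g)) /=.
by apply: eq_bigr => h _; rewrite dual_iota_mul /= mulKg.
Qed.

Lemma orbit_sums_surj (r : 'rV[k]_#|S|) :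
  exists2 v, v \in coradical1 H & orbit_sums v = r.
Proof.
pose v := \sum_i r 0 i *: e (1%g, enum_val i).
have dv w : dual e w v =
    \sum_i r 0 i * ((w.1 == 1%g) && (w.2 == enum_val i))%:R.
  rewrite linear_sum; apply: eq_bigr => i _.
  by rewrite linearZ /= (dualE e_basis) pairE.
exists v.
  apply/coradical1_dualP => w wS; rewrite dv big1 // => i _.
  case: (w.2 =P enum_val i) => [w2|_]; last by rewrite andbF mulr0.
  by rewrite w2 enum_valP in wS.
apply/rowP => i; rewrite mxE (bigD1 1%g) //= big1 => [|g /negPf g1].
  rewrite addr0 dv (bigD1 i) //= big1 => [|j neq_ji].
    by rewrite !eqxx mulr1 addr0.
  by rewrite (inj_eq enum_val_inj) [i == j]eq_sym (negPf neq_ji) andbF mulr0.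
by rewrite dv big1 // => j _; rewrite g1 mulr0.
Qed.

(** The relations kill every difference g x^i - x^i with i in S, and an element
    of H_1 whose orbit sums vanish is a combination of such differences. *)
Lemma mem_balanced_relations X : tensor_unitor X \in coradical1 H ->
  (X \in balanced_relations H) = (orbit_sums (tensor_unitor X) == 0).
Proof.
move=> XH1; apply/idP/eqP => [|Xev0].
  rewrite -[orbit_sums _](lfunE (orbit_sums \o @tensor_unitor k H)) => XB.
  apply/eqP; rewrite -memv_ker; apply: subvP XB.
  apply/span_subvP => _ /allpairsP[[h v] [/= /vbasis_mem hH0 _ ->]].
  rewrite memv_ker lfunE /= linearB /= !tensor_unitorE scale1r linearB subr_eq0.
  apply/eqP; rewrite linearZ /= (coradical_sum hH0) linear_sum mulr_suml.
  rewrite linear_sum /= scaler_suml; apply: eq_bigr => g _.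
  rewrite -scalerAl !linearZ /= orbit_sums_iota; congr (_ *: _).
  by rewrite counit_iota mulr1.
rewrite (tens1_unitor X); set v := tensor_unitor X in XH1 Xev0 *.
have ->: v = \sum_w dual e w v *: (e w - e (1%g, w.2)).
  under eq_bigr do rewrite scalerBr.
  rewrite sumrB -(dual_sum e_basis) [X in _ - X](_ : _ = 0) ?subr0 //.
  transitivity (\sum_i \sum_g dual e (g, i) v *: e (1%g, i)).
    by rewrite exchange_big pair_bigA; apply: eq_bigr => -[].
  rewrite big1 // => i _; rewrite -scaler_suml.
  have [iS|iS] := boolP (i \in S).
    have /rowP/(_ (enum_rank_in iS i)) := Xev0.
    by rewrite !mxE enum_rankK_in // => ->; rewrite scale0r.
  rewrite big1 ?scale0r // => g _.
  by move/coradical1_dualP: XH1 => ->.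
rewrite linear_sum; apply: memv_suml => w _; rewrite linearZ /=.
have [wS|wS] := boolP (w.2 \in S); last first.
  by move/coradical1_dualP: XH1 => -> //; rewrite scale0r mem0v.
rewrite memvZ //= -opprB linearN memvN linearB.
have := @balanced_relationsP k H 1 (iota w.1) (e (1%g, w.2)).
rewrite counit_iota mulr1 {2}/e mulrA -iotaM mulg1; apply.
  exact: iota_coradical.
apply/coradical1_dualP => s sS; rewrite (dualE e_basis) pairE.
by case: eqP sS => [_|] //=; case: eqP => [->|] //; rewrite wS.
Qed.

Lemma dim_triv_tensor_coradical1E : dim_triv_tensor_coradical1 H = #|S|.
Proof.
rewrite /dim_triv_tensor_coradical1; set T := tensv _ _.
set B := balanced_relations H.
pose f := linfun (orbit_sums \o @tensor_unitor k H).
have evT X : X \in T -> tensor_unitor X \in coradical1 H.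
  rewrite -[tensor_unitor X](lfunE (@tensor_unitor k H)) memv_preim.
  apply: subvP.
  apply/span_subvP => _ /allpairsP[[c v] [/= _ /vbasis_mem vH1 ->]].
  by rewrite -memv_preim lfunE /= tensor_unitorE memvZ.
have TB : (T :&: B = T :&: lker f)%VS.
  apply/vspaceP => X; rewrite !memv_cap.
  case: (boolP (X \in T)) => //= /evT XH1.
  by rewrite mem_balanced_relations // memv_ker lfunE.
have fT : (f @: T = fullv)%VS.
  apply/vspaceP => r; rewrite memvf; apply/memv_imgP.
  have [v vH1 <-] := orbit_sums_surj r.
  exists (tens (1 : k^o) v); first by rewrite tensv_mem ?memvf.
  by rewrite lfunE /= tensor_unitorE scale1r.
apply/eqP; rewrite -(eqn_add2l (\dim (T :&: B))) dimv_cap_compl TB.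
by rewrite -(limg_ker_dim f T) fT dimvf dim_matrix mul1r.
Qed.

End SkewPrimitive.

(** * Rank one *)

Lemma prim_rootV (k : fieldType) (z : k) N :
  N.-primitive_root z -> N.-primitive_root z^-1.
Proof.
case/andP=> N0 /forallP zN; apply/andP; split=> //; apply/forallP => i.
by rewrite -(eqP (zN i)) !unity_rootE exprVn invr_eq1.
Qed.

Lemma card_coradical1_degrees (k : fieldType) n (u : k) : (1 < n)%N ->
  #|coradical1_degrees n u|
    = (#|[set i in coradical1_degrees n u | (1 < i)%N]|).+2.
Proof.
move=> n_gt1; set S := coradical1_degrees n u.
have SE : S = Ordinal (ltnW n_gt1) |:
    (Ordinal n_gt1 |: [set i in S | (1 < i)%N]).
  apply/setP => i; rewrite !inE -!val_eqE /=.
  case: (ltngtP i 1) => [|i1|->] /=; rewrite ?andbT ?andbF ?orbF //.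
    rewrite ltnS leqn0 => /eqP i0; rewrite i0 eqxx.
    by apply/forallP => j; rewrite ltn0 andbF.
  - by rewrite gtn_eqF // ltnW.
  by apply/forallP => j; case: (val j) => // m; rewrite !ltnS.
by rewrite {1}SE !cardsU1 !inE -!val_eqE /= !andbF.
Qed.

Section RankOne.
Context (k : fieldType) (G : finGroupType) (H : hopfAlgType k).
Context (iota : G -> H) (x : H) (a : G) (n : nat) (u : k).
Context (H_basis : hopf_on_basis iota x a n) (n_gt1 : (1 < n)%N).
Context (xa : x * iota a = u *: (iota a * x)).

Let n_gt0 : (0 < n)%N := ltnW n_gt1.

Lemma has_rank1P : has_rank H 1 <->
  forall i : 'I_n, (1 < i)%N -> i \notin coradical1_degrees n u.
Proof.
rewrite /has_rank (dim_triv_tensor_coradical1E H_basis n_gt0 xa).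
rewrite card_coradical1_degrees //; split=> [[_ [/eqP]]|no_deg].
  rewrite cards_eq0 => /eqP S0 i i1; apply/negP => iS.
  by have := in_set0 i; rewrite -S0 inE iS i1.
split; first exact: pointed_skew H_basis n_gt0 xa.
congr _.+2; apply/eqP; rewrite cards_eq0; apply/eqP/setP => i.
rewrite [in RHS]inE inE andbC; case: ltnP => //= i1.
exact/negbTE/no_deg.
Qed.

(** One nonvanishing middle coefficient already keeps x^i out of H_1. *)
Lemma has_rank1 : (forall i, (1 < i < n)%N -> gbin u i 1 != 0) -> has_rank H 1.
Proof.
move=> b1; apply/has_rank1P => i i1; rewrite inE; apply/negP.
move=> /forallP/(_ (Ordinal n_gt1)); rewrite /= i1 /= => /eqP b0.
by have := b1 i; rewrite i1 ltn_ord b0 eqxx => /(_ isT).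
Qed.

End RankOne.

Theorem proposition3p10 (k : fieldType) (p : nat) (hp : p \in [pchar k]) :
  (forall (R : datumR k p) (H : hopfAlgType k), is_HR R H ->
     pointed H /\ (has_rank H 1 <-> R_r R = 0%N)) /\
  (forall (F : datumF k p) (H : hopfAlgType k), is_HF F H ->
     pointed H /\ has_rank H 1).
Proof.
have p_gt1 : (1 < p)%N by have [/prime_gt1] := andP hp.
split=> [R H [iota [x [H_basis xg _]]] | F H [iota [x [H_basis xg _]]]];
  have [[iota1 iotaM _] _] := H_basis.
- pose u := (R_chi R (R_a R))^-1.
  have xa : x * iota (R_a R) = u *: (iota (R_a R) * x).
    rewrite -[iota (R_a R) * x]mulr1 -iota1 -(mulVg (R_a R)) iotaM mulrA xg.
    by rewrite -scalerAl scalerA mulVf ?R_chi_neq0 // scale1r.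
  have u_prim : (R_N R).-primitive_root u by apply/prim_rootV/R_N_order.
  have N_gt1 : (1 < R_N R)%N.
    have := R_chia R; have := R_N_order R; have := prim_order_gt0 u_prim.
    case: (R_N R) => [|[|//]] // _ /prim_expr_order; rewrite expr1 => ->.
    by rewrite eqxx.
  have n_gt1 : (1 < R_n R)%N.
    by apply: leq_trans N_gt1 _; rewrite leq_pmull // expn_gt0 ltnW.
  split; first exact: pointed_skew H_basis (ltnW n_gt1) xa.
  split=> [|r0]; last first.
    apply: (has_rank1 H_basis n_gt1 xa) => i /andP[i1 lt_in].
    apply: gbin1_neq0 u_prim _; move: lt_in; rewrite /R_n r0 mul1n => ->.
    by rewrite ltnW.
  (* If r > 0, then x^N with 1 < N < n is in H_1. *)
  move=> /(has_rank1P H_basis n_gt1 xa) no_deg; apply/eqP.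
  rewrite -leqn0 leqNgt; apply/negP => r_gt0.
  have lt_Nn : (R_N R < R_n R)%N.
    by rewrite ltn_Pmull ?(ltnW N_gt1) // -(expn0 p) ltn_exp2l.
  have /negP[] := no_deg (Ordinal lt_Nn) N_gt1.
  rewrite inE; apply/forallP => j; apply/implyP.
  by move=> /(gbin_prim_root u_prim)->.
have xa : x * iota (F_a F) = 1 *: (iota (F_a F) * x).
  rewrite scale1r -[iota (F_a F) * x]mulr1 -iota1 -(mulVg (F_a F)) iotaM.
  by rewrite mulrA xg F_chia F_ca scale1r scale0r addr0.
split; first exact: pointed_skew H_basis (ltnW p_gt1) xa.
apply: (has_rank1 H_basis p_gt1 xa) => i /andP[i1 lt_ip].
by rewrite gbin_1q -(dvdn_pcharf hp) gtnNdvd // ltnW.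
Qed.
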